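(* Let $P=\{p_1,\ldots,p_n\}$ be a finite poset and let $r\ge s\ge 1$ be integers. Then (a) the Alexander dual $H_r(P)$ of $I_r(P)$ is the ideal $(u_{\mathcal I} : \mathcal I\in\mathcal I_r(P))$; (b) the Alexander dual $H_{r,s}(P)$ of $I_{r,s}(P)$ is the ideal $H_r(P)^{\langle r-s+1\rangle}$.
   Context: $K$ is a field and $S=K[x_{ij} : 1\le i\le r,\ 1\le j\le n]$. A multichain of length $r$ in $P$ is a sequence $C: p_{j_1}\le p_{j_2}\le\cdots\le p_{j_r}$ of elements of $P$ (repetitions allowed); $\mathcal C_r(P)$ is the set of these. For $C\in\mathcal C_r(P)$ and $\emptyset\ne A\subseteq[r]=\{1,\ldots,r\}$ set $u_{C,A}=\prod_{i\in A}x_{ij_i}$. The ideal $I_{r,s}(P)\subset S$ is generated by all $u_{C,A}$ with $C\in\mathcal C_r(P)$, $A\subseteq[r]$, $|A|=s$; and $I_r(P)=I_{r,r}(P)$. The Alexander dual $I^\vee$ of a squarefree monomial ideal $I$ is the ideal generated by the monomials $\prod_{x\in F}x$, where $F$ ranges over the sets of variables generating the minimal prime ideals of $I$. Put $H_{r,s}(P)=I_{r,s}(P)^\vee$ and $H_r(P)=H_{r,r}(P)$. A poset ideal of $P$ is a down-closed subset (possibly empty). $\mathcal I_r(P)$ is the set of multichains $\mathcal I: I_1\subseteq I_2\subseteq\cdots\subseteq I_r=P$ of poset ideals of $P$. For such $\mathcal I$, set $I_0=\emptyset$, $J_j=I_j\setminus I_{j-1}$, and $u_{\mathcal I}=\prod_{j=1}^r\prod_{p_k\in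 J_j}x_{jk}$. For a squarefree monomial ideal $L$, $L^{\langle k\rangle}$ denotes its $k$-th squarefree power, i.e. the ideal generated by all squarefree monomials in $L^k$. *)

(* Defs.v *)
From HB Require Import structures.
From mathcomp Require Import classical_sets.
(* imported last so that [set0] and [set: T] keep their finset meaning; sets
   of polynomials (ideals) are [classical_sets.set]s, written in [%classic] *)
From mathcomp Require Import all_boot all_order all_algebra mpoly.

Set Implicit Arguments.
Unset Strict Implicit.
Unset Printing Implicit Defensive.

Import Order.TTheory GRing.Theory.
Local Open Scope ring_scope.

Section Ideals.
Variable R : comNzRingType.
Implicit Types (I J Q G : set R) (k : nat).

(* Unlike [idealr_closed] of ring_quotient, this admits the unit ideal, which
   does occur as an Alexander dual (that of the zero ideal). *)
Definition is_ideal I : Prop :=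
  [/\ I 0,
      forall x y, I x -> I y -> I (x + y)
    & forall a x, I x -> I (a * x)].

Definition ideal_gen G : set R := smallest is_ideal G.

Definition is_prime_ideal Q : Prop :=
  [/\ is_ideal Q, ~ Q 1 & forall x y, Q (x * y) -> Q x \/ Q y].

Definition is_minimal_prime I Q : Prop :=
  [/\ is_prime_ideal Q, (I `<=` Q)%classic
    & forall Q', is_prime_ideal Q' ->
        (I `<=` Q')%classic -> (Q' `<=` Q)%classic -> Q' = Q].

Definition ideal_pow I k : set R :=
  ideal_gen (fun f => exists2 g : 'I_k -> R,
    (forall i, I (g i)) & f = \prod_(i < k) g i).

End Ideals.

Section SquarefreeMonomialIdeals.
Variables (K : fieldType) (N : nat).
Local Notation S := {mpoly K[N]}.
Implicit Types (I L : set S) (F : {set 'I_N}) (k : nat).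

Definition var_ideal F : set S :=
  ideal_gen (fun f => exists2 v, v \in F & f = 'X_v).

(* Alexander dual and squarefree powers are used on squarefree monomial ideals
   only; on other ideals the values below have no meaning. *)
Definition alexander_dual I : set S :=
  ideal_gen (fun f => exists2 F : {set 'I_N},
    is_minimal_prime I (var_ideal F) & f = \prod_(v in F) 'X_v).

Definition sqfree_monomial (f : S) : Prop :=
  exists2 m : 'X_{1..N}, (forall v, (m v <= 1)%N) & f = 'X_[m].

Definition sqfree_pow L k : set S :=
  ideal_gen (fun f => sqfree_monomial f /\ ideal_pow L k f).

End SquarefreeMonomialIdeals.

Section PosetIdeals.
Variables (K : fieldType) (d : Order.disp_t) (P : finPOrderType d).
Variables (n : nat) (p : 'I_n -> P).
Implicit Types (r s : nat).

(* S = K[x_ij : i in 'I_r, j in 'I_n]; [mxvec_index] is a bijection from pairs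
   of indices onto 'I_(r * n). *)
Definition xvar r (i : 'I_r) (j : 'I_n) : {mpoly K[r * n]} :=
  'X_(mxvec_index i j).

(* The sequence of labels c stands for p_(c_1) <= ... <= p_(c_r). *)
Definition multichain r (c : r.-tuple 'I_n) : bool :=
  sorted <=%O [seq p j | j <- c].

Definition u_chain r (c : r.-tuple 'I_n) (A : {set 'I_r}) :
    {mpoly K[r * n]} :=
  \prod_(i in A) xvar i (tnth c i).

Definition chain_ideal r s : set {mpoly K[r * n]} :=
  ideal_gen (fun f => exists c : r.-tuple 'I_n, exists A : {set 'I_r},
    [/\ multichain c, #|A| = s & f = u_chain c A]).

Arguments chain_ideal r s : clear implicits.

Definition H_ideal r s : set {mpoly K[r * n]} :=
  alexander_dual (chain_ideal r s).

Definition poset_ideal (D : {set P}) : Prop :=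
  forall x y : P, (x <= y)%O -> y \in D -> x \in D.

(* I_1, ..., I_r is the sequence of entries of I; for r >= 1 the condition on
   [last] says I_r = P. *)
Definition ideal_multichain r (I : r.-tuple {set P}) : Prop :=
  [/\ forall i, poset_ideal (tnth I i),
      sorted (fun D E : {set P} => D \subset E) I
    & last set0 I = [set: P]].

(* Positions start at 0, so the entry of [set0 :: I] at position j is the
   predecessor of the entry of I at position j, with I_0 = set0. *)
Definition layer r (I : r.-tuple {set P}) (j : 'I_r) : {set P} :=
  tnth I j :\: nth set0 (set0 :: I) j.

Definition u_ideals r (I : r.-tuple {set P}) : {mpoly K[r * n]} :=
  \prod_(j < r) \prod_(k < n | p k \in layer I j) xvar j k.

Definition ideals_ideal r : set {mpoly K[r * n]} :=
  ideal_gen (fun f => exists2 I : r.-tuple {set P},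
    ideal_multichain I & f = u_ideals I).

End PosetIdeals.

Arguments chain_ideal K {d P n} p r s _.
Arguments H_ideal K {d P n} p r s _.
Arguments ideals_ideal K {d P n} p r _.

(* Main.v *)
Require Import Defs.
From mathcomp Require Import boolp classical_sets.
From mathcomp Require Import all_boot all_order all_algebra mpoly.
From mathcomp Require Import zify.

(** Call a pair [(i, j)] of indices of a variable a cell.  A prime ideal
    containing a squarefree monomial ideal contains a variable of each generator,
    so the minimal primes of such an ideal that are generated by variables
    correspond to the minimal vertex covers of the supports of the generators
    ([minimal_prime_minset]).  The Alexander dual is therefore generated by the
    monomials of all the vertex covers ([alexander_dual_edge_ideal]).  For
    [I_{r,s}(P)] a set of cells [F] is a vertex cover exactly when it meets the
    graph of every multichain in at least [r - s + 1] cells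
    ([covers_chain_edge]); such a set is called a [(r - s + 1)]-fold cover.

    Both parts rest on one function of a set of cells [F], the [height]: the
    least number of cells of [F] met by a chain of length [i] that ends at a
    given element.  It never increases by more than 1 along a chain, and it
    increases only on cells of [F].

    For (a), the support of [u_I] meets every multichain: at the first position
    [i] with [p_(c_i)] in [I_i], the element cannot lie in [I_(i-1)], since its
    predecessor in the chain would lie there too ([ideal_cells_kcover]).
    Conversely, given a cover [F], the elements above no element of height 0
    at position [i] form poset ideals [I_i], and the support of the
    resulting [u_I] lies in [F] ([kcover_ideal_cells]).

    For (b), let [F] be a [k]-fold cover.  The cells of [F] of height [t], for
    [t = 1, ..., k], form [k] disjoint subsets of [F], each of them a cover
    ([kcover_split]); hence the monomial of [F] lies in [H_r(P)^k].  Conversely,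
    every generator of [H_r(P)] has degree at least 1 along each multichain, so
    every monomial occurring in an element of [H_r(P)^k] has degree at least [k]
    along it ([degree_ge_ideal_pow]), and the support of a squarefree one is a
    [k]-fold cover. *)

Set Implicit Arguments.
Unset Strict Implicit.
Unset Printing Implicit Defensive.

Import Order.TTheory GRing.Theory.

(** * Generated ideals *)

Section GeneratedIdeals.
Local Open Scope ring_scope.
Variable R : comNzRingType.
Implicit Types (I G : set R) (x a : R).

Lemma ideal_gen_is_ideal G : is_ideal (ideal_gen G).
Proof.
split=> [J [[J0 _ _] _] //|x y Gx Gy J JP|a x Gx J JP].
  by case: (JP) => -[_ JD _] _; apply: JD; [apply: Gx|apply: Gy].
by case: (JP) => -[_ _ JM] _; apply: JM; apply: Gx.
Qed.

Lemma mem_ideal_gen G x : G x -> ideal_gen G x.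
Proof. by move=> Gx; apply: sub_gen_smallest. Qed.

Lemma ideal_gen_sub G I :
  is_ideal I -> (forall x, G x -> I x) -> forall x, ideal_gen G x -> I x.
Proof. by move=> idI GI x; apply: smallest_sub. Qed.

Lemma ideal_genMl G a x : ideal_gen G x -> ideal_gen G (a * x).
Proof. by case: (ideal_gen_is_ideal G) => _ _; apply. Qed.

Lemma eq_ideal_gen G1 G2 :
    (forall x, G1 x -> ideal_gen G2 x) -> (forall x, G2 x -> ideal_gen G1 x) ->
  ideal_gen G1 = ideal_gen G2.
Proof.
move=> G12 G21; apply/seteqP.
by split=> x; apply: ideal_gen_sub => //; apply: ideal_gen_is_ideal.
Qed.

Lemma prime_ideal_prod (Q : set R) (T : finType) (A : {set T}) (f : T -> R) :
  is_prime_ideal Q -> Q (\prod_(i in A) f i) -> exists2 i, i \in A & Q (f i).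
Proof.
move=> [_ Q1 Qprime].
elim/big_rec: _ => [/Q1 //|i x iA IH] /Qprime[Qi|/IH //].
by exists i.
Qed.

End GeneratedIdeals.

(** * Squarefree monomials and ideals generated by variables *)

Section SquarefreeMonomials.
Local Open Scope ring_scope.
Variables (K : fieldType) (N : nat).
Local Notation S := {mpoly K[N]}.
Implicit Types (F E : {set 'I_N}) (m : 'X_{1..N}) (f g : S).

(** The squarefree monomial with support [F]. *)
Definition sqfree_mon F : S := \prod_(v in F) 'X_v.

Lemma sqfree_monE F :
  sqfree_mon F = 'X_[[multinom nat_of_bool (v \in F) | v < N]].
Proof.
rewrite mpolyXE_id /sqfree_mon big_mkcond /=; apply: eq_bigr => v _.
by rewrite mnmE; case: (v \in F).
Qed.

Lemma sqfree_monomial_sqfree_mon F : sqfree_monomial (sqfree_mon F).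
Proof.
exists [multinom nat_of_bool (v \in F) | v < N]; last exact: sqfree_monE.
by move=> v; rewrite mnmE leq_b1.
Qed.

Lemma sqfree_monomialP f : sqfree_monomial f -> exists F, f = sqfree_mon F.
Proof.
move=> [m m1 ->]; exists [set v | m v == 1%N]; rewrite sqfree_monE.
congr mpolyX; apply/mnmP => v; rewrite mnmE inE.
by case: (m v) (m1 v) => [|[|]].
Qed.

Lemma sqfree_mon_subset E F :
  E \subset F -> sqfree_mon F = sqfree_mon (F :\: E) * sqfree_mon E.
Proof.
move=> /setIidPr EF; rewrite /sqfree_mon (big_setID E) /= EF.
by rewrite mulrC.
Qed.

Lemma ideal_gen_sqfree_monS (G : set S) E F :
  E \subset F -> G (sqfree_mon E) -> ideal_gen G (sqfree_mon F).
Proof.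
move=> EF GE; rewrite (sqfree_mon_subset EF); apply: ideal_genMl.
exact: mem_ideal_gen.
Qed.

(** The substitution sending the variables indexed by [F] to 0 and fixing the
    others; its kernel is [var_ideal F]. *)
Definition kill_vars F : N.-tuple S :=
  [tuple (if v \in F then 0 else 'X_v) | v < N].

Lemma kill_varsX F v : 'X_v \mPo kill_vars F = if v \in F then 0 else 'X_v.
Proof. by rewrite comp_mpolyXU -tnth_nth tnth_mktuple. Qed.

Lemma kill_vars_congr F f : var_ideal F (f - (f \mPo kill_vars F)).
Proof.
have [J0 JD JM] := ideal_gen_is_ideal
  (fun g : S => exists2 v, v \in F & g = 'X_v).
pose Q g := var_ideal F (g - (g \mPo kill_vars F)).
have QM g h : Q g -> Q h -> Q (g * h).
  move=> Qg Qh; rewrite /Q rmorphM /=.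
  set g' := g \mPo _; set h' := h \mPo _.
  have -> : g * h - g' * h' = h * (g - g') + g' * (h - h').
    by rewrite !mulrBr addrA (mulrC h g) (mulrC h g') subrK.
  by apply: JD; apply: JM.
have QX v : Q 'X_v.
  rewrite /Q kill_varsX; case: ifP => vF; last by rewrite subrr.
  by rewrite subr0; apply: mem_ideal_gen; exists v.
have Q1 : Q 1 by rewrite /Q rmorph1 subrr.
elim/mpolyind: f => [|c m g _ _ Qg]; first by rewrite rmorph0 subrr.
rewrite rmorphD /= opprD addrACA; apply: JD => //.
rewrite comp_mpolyZ -scalerBr -mul_mpolyC; apply: JM.
rewrite -/(Q 'X_[m]) mpolyXE_id; elim/big_rec: _ => // v g' _.
by apply: (QM); elim: (m v) => [|k IHk]; rewrite ?expr0 // exprS; apply: QM.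
Qed.

Lemma var_idealP F f : var_ideal F f <-> f \mPo kill_vars F = 0.
Proof.
split=> [|f0]; last by have := @kill_vars_congr F f; rewrite f0 subr0.
pose I : set S := fun g => g \mPo kill_vars F = 0.
apply: (@ideal_gen_sub _ _ I) => [|_ [v vF ->]]; last by rewrite /I kill_varsX vF.
split=> [|g h g0 h0|a g g0]; first exact: rmorph0.
  by rewrite /I rmorphD /= g0 h0 addr0.
by rewrite /I rmorphM /= g0 mulr0.
Qed.

Lemma var_ideal_prime F : is_prime_ideal (@var_ideal K N F).
Proof.
split; first exact: ideal_gen_is_ideal.
  by move/var_idealP; rewrite rmorph1; apply/eqP/oner_neq0.
move=> f g /var_idealP; rewrite rmorphM => /eqP.
by rewrite mulf_eq0 => /orP[] /eqP ?; [left|right]; apply/var_idealP.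
Qed.

Lemma var_ideal_var F v : @var_ideal K N F 'X_v <-> v \in F.
Proof.
split=> [/var_idealP|vF]; last by apply: mem_ideal_gen; exists v.
by rewrite kill_varsX; case: ifP => // _ /eqP; rewrite -msupp_eq0 msuppX.
Qed.

Lemma var_ideal_sqfree_mon F E :
  var_ideal F (sqfree_mon E) <-> exists2 v, v \in E & v \in F.
Proof.
split=> [/(prime_ideal_prod (var_ideal_prime F))[v vE /var_ideal_var]|[v vE vF]].
  by exists v.
rewrite /sqfree_mon (big_setD1 v vE) /= mulrC; apply: ideal_genMl.
exact/var_ideal_var.
Qed.

Lemma var_ideal_inj : injective (@var_ideal K N).
Proof.
by move=> E F EF; apply/setP=> v; apply/idP/idP; rewrite -!var_ideal_var EF.
Qed.

(** ** Alexander duality through vertex covers *)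

Section Covers.
Variable G : {set 'I_N} -> Prop.

(** [F] is a vertex cover of the hypergraph with edge set [G]. *)
Definition covers F : Prop := forall E, G E -> exists2 v, v \in E & v \in F.

(** The ideal generated by the squarefree monomials of the edges. *)
Definition edge_ideal : set S :=
  ideal_gen (fun f => exists2 E, G E & f = sqfree_mon E).

Lemma coversP F : (edge_ideal `<=` var_ideal F)%classic <-> covers F.
Proof.
split=> [GF E GE|FG].
  by apply/var_ideal_sqfree_mon; apply: GF; apply: mem_ideal_gen; exists E.
apply: ideal_gen_sub; first exact: ideal_gen_is_ideal.
by move=> _ [E /FG EF ->]; apply/var_ideal_sqfree_mon.
Qed.

Lemma minimal_prime_minset F :
  is_minimal_prime edge_ideal (var_ideal F)
  <-> minset (fun E => `[< covers E >]) F.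
Proof.
split=> [[_ /coversP FG Fmin]|/minsetP[/asboolP FG Fmin]].
  apply/minsetP; split=> [|E /asboolP EG EF]; first exact/asboolP.
  apply: var_ideal_inj; apply: Fmin; [exact: var_ideal_prime|exact/coversP|].
  apply: ideal_gen_sub => [|_ [v vE ->]]; first exact: ideal_gen_is_ideal.
  exact/var_ideal_var/(subsetP EF).
split; [exact: var_ideal_prime|exact/coversP|].
move=> Q Qprime GQ QF; apply/seteqP; split=> //.
(* the variables lying in the prime Q form a cover contained in F *)
pose E := [set v | `[< Q 'X_v >]].
have EG : covers E.
  move=> D GD; have [v vD Qv] : exists2 v, v \in D & Q 'X_v.
    apply: (prime_ideal_prod Qprime); apply: GQ; apply: mem_ideal_gen.
    by exists D.
  by exists v => //; rewrite inE; apply/asboolP.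
have <- : E = F.
  apply: Fmin; first exact/asboolP.
  by apply/subsetP=> v; rewrite inE => /asboolP/QF/var_ideal_var.
apply: ideal_gen_sub => [|_ [v vE ->]]; first by case: Qprime.
by move: vE; rewrite inE => /asboolP.
Qed.

Lemma alexander_dual_edge_ideal :
  alexander_dual edge_ideal =
  ideal_gen (fun f => exists2 F, covers F & f = sqfree_mon F).
Proof.
apply: eq_ideal_gen => _ [F FP ->].
  apply: mem_ideal_gen; exists F => //.
  by case/minimal_prime_minset/minsetP: FP => /asboolP.
have [E Emin EF] := minset_exists (asboolT FP : (fun E => `[< covers E >]) F).
by apply: (ideal_gen_sqfree_monS EF); exists E => //; apply/minimal_prime_minset.
Qed.

End Covers.

(** ** Degree along a set of variables *)

Section DegreeAlong.
Variable A : {set 'I_N}.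

(** The [t]-th power of [var_ideal A], described by degrees: every monomial
    has degree at least [t] in the variables indexed by [A]. *)
Definition degree_ge t : set S :=
  fun f => forall m, m \in msupp f -> (t <= \sum_(v in A) m v)%N.

Lemma degree_geM t u f g :
  degree_ge t f -> degree_ge u g -> degree_ge (t + u) (f * g).
Proof.
move=> ft gu m /msuppM_le /allpairsP[[m1 m2] /= [/ft le1 /gu le2 ->]].
under eq_bigr do rewrite mnmDE.
by rewrite big_split leq_add.
Qed.

Lemma degree_ge_is_ideal t : is_ideal (degree_ge t).
Proof.
split=> [m|f g ft gt m /msuppD_le|a f ft]; first by rewrite msupp0.
  by rewrite mem_cat => /orP[/ft|/gt].
by apply: (@degree_geM 0).
Qed.

Lemma degree_ge_sqfree_mon t F :
  degree_ge t (sqfree_mon F) <-> (t <= #|A :&: F|)%N.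
Proof.
have degE : (\sum_(v in A) [multinom nat_of_bool (v \in F) | v < N] v)%N
            = #|A :&: F|.
  rewrite -sum1_card (big_setID F) /= [X in (_ + X)%N]big1 => [|v].
    by rewrite addn0; apply: eq_bigr => v; rewrite mnmE inE => /andP[_ ->].
  by rewrite mnmE inE => /andP[/negPf ->].
split=> [|tF m]; rewrite sqfree_monE ?msuppX ?inE.
  move=> /(_ [multinom nat_of_bool (v \in F) | v < N]).
  by rewrite msuppX inE eqxx degE => /(_ isT).
by move=> /eqP ->; rewrite degE.
Qed.

Lemma degree_ge_ideal_pow (I : set S) k f :
  (forall g, I g -> degree_ge 1 g) -> ideal_pow I k f -> degree_ge k f.
Proof.
move=> I1; apply: ideal_gen_sub => [|_ [g Ig ->]].
  exact: degree_ge_is_ideal.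
elim: k g Ig => [|k IHk] g Ig; first by move=> m.
by rewrite big_ord_recl; apply: (@degree_geM 1 k); [apply: I1|apply: IHk].
Qed.

End DegreeAlong.

Lemma ideal_pow_disjoint (I : set S) k (A : 'I_k -> {set 'I_N}) F :
    (forall t, I (sqfree_mon (A t))) -> (forall t, A t \subset F) ->
    (forall t u, t != u -> [disjoint A t & A u]) ->
  ideal_pow I k (sqfree_mon F).
Proof.
move=> IA AF disj; have UF : \bigcup_t A t \subset F by apply/bigcupsP.
apply: (ideal_gen_sqfree_monS UF); exists (fun t => sqfree_mon (A t)) => //.
by rewrite /sqfree_mon (partition_disjoint_bigcup _ _ disj).
Qed.

End SquarefreeMonomials.

Arguments edge_ideal K {N} G _.

(** * Chains in a preorder and the cells they meet *)

Section ChainHits.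
Variables (T : finType) (e : rel T) (B : nat -> T -> bool).
Hypothesis e_refl : reflexive e.
Implicit Types (i j t : nat) (x y : T) (c : seq T).

(** A chain [c] passes through the cells [(j, c_j)], with positions [j] starting
    at 0.  For [i > 0], [low i x] is the least number of cells satisfying [B] on a
    chain of length [i] that ends at [x]; [low 0 x] is 0, the number of cells on
    the empty chain. *)
Fixpoint low i x : nat :=
  if i is i'.+1 then low i' [arg min_(y < x | e y x) low i' y] + B i' x else 0.

Lemma low_le i x y : e y x -> low i.+1 x <= low i y + B i x.
Proof.
by move=> yx /=; case: arg_minnP => // z _ zmin; rewrite leq_add2r zmin.
Qed.

Lemma low_prev i x : exists2 y, e y x & low i.+1 x = low i y + B i x.
Proof. by rewrite /=; case: arg_minnP => // y yx _; exists y. Qed.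

(** The minimum is attained: some chain ending at [x] meets exactly
    [low] cells. *)
Lemma low_attained x0 i x :
  exists c, [/\ size c = i, sorted e (rcons c x)
    & low i.+1 x = \sum_(j < i.+1) B j (nth x0 (rcons c x) j)].
Proof.
elim: i x => [|i IHi] x; first by exists [::]; split; rewrite // big_ord1.
have [y yx ->] := low_prev i.+1 x.
have [c [<- c_sorted ->]] := IHi y.
exists (rcons c y); split; first by rewrite size_rcons.
  by case: c c_sorted => [|z c] /=; rewrite ?yx // !rcons_path last_rcons => ->.
rewrite [RHS]big_ord_recr /= [in RHS]nth_rcons size_rcons ltnn eqxx.
congr (_ + _); apply: eq_bigr => j _.
by rewrite [in RHS]nth_rcons size_rcons ltn_ord.
Qed.

(** Along a chain the values of [low] rise by at most 1 at each step, and only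
    on cells satisfying [B], so each value [t] from 1 up to the last one is first
    reached on such a cell. *)
Lemma low_hits_level x0 c t :
    sorted e c -> 0 < t -> t <= low (size c) (last x0 c) ->
  exists j, [/\ j < size c, B j (nth x0 c j) & low j.+1 (nth x0 c j) = t].
Proof.
move=> c_sorted t_gt0 t_le.
have c_gt0 : 0 < size c by case: c t_le {c_sorted} => //; rewrite leqNgt t_gt0.
(* the first position at which low reaches t *)
pose Q j := (j < size c) && (t <= low j.+1 (nth x0 c j)).
have exQ : exists j, Q j.
  by exists (size c).-1; rewrite /Q nth_last prednK // leqnn.
case: (ex_minnP exQ) => j /andP[jc tj] jmin.
have [y y_lt yx] : exists2 y, low j y < t & e y (nth x0 c j).
  case: j jc {tj} jmin => [|j] jc jmin; first by exists (nth x0 c 0).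
  exists (nth x0 c j); last exact: (sortedP x0 c_sorted).
  by rewrite ltnNge; apply: contraTN (ltnSn j) => ?;
    rewrite -leqNgt jmin // /Q ltnW.
have := low_le j yx; case Bj: (B j _) => low_j; last by lia.
by exists j; split=> //; lia.
Qed.

End ChainHits.

(** * Cells of the grid and multichains *)

Section Cells.
Variables (r n : nat).
Implicit Types (Q : 'I_r -> 'I_n -> bool) (c : r.-tuple 'I_n).
Implicit Types (A : {set 'I_r}) (F : {set 'I_(r * n)}).

Lemma mxvec_index_inj :
  injective (fun ij : 'I_r * 'I_n => mxvec_index ij.1 ij.2).
Proof.
have [g gK _] := curry_mxvec_bij r n.
by apply: (can_inj (g := g)) => -[i j]; apply: (gK (i, j)).
Qed.

(** The set of variables [x_ij] with [Q i j]. *)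
Definition cells Q : {set 'I_(r * n)} :=
  [set mxvec_index ij.1 ij.2 | ij : 'I_r * 'I_n & Q ij.1 ij.2].

Lemma mem_cells Q i j : (mxvec_index i j \in cells Q) = Q i j.
Proof. by rewrite (mem_imset _ (i, j) mxvec_index_inj) inE. Qed.

Lemma cells_subset Q F :
  (forall i j, Q i j -> mxvec_index i j \in F) -> cells Q \subset F.
Proof. by move=> QF; apply/subsetP=> _ /imsetP[[i j] /[!inE] /QF ? ->]. Qed.

(** The cells [(i, c_i)] with [i] in [A]: the support of [u_chain c A]. *)
Definition chain_cells c A : {set 'I_(r * n)} :=
  [set mxvec_index i (tnth c i) | i in A].

Lemma chain_cell_inj c : injective (fun i => mxvec_index i (tnth c i)).
Proof. by move=> i j /(@mxvec_index_inj (i, _) (j, _)) []. Qed.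

Lemma card_chain_cells c F :
  #|chain_cells c [set: 'I_r] :&: F|
  = #|[set i | mxvec_index i (tnth c i) \in F]|.
Proof.
rewrite -(card_imset _ (@chain_cell_inj c)); apply: eq_card => v.
apply/setIP/imsetP => [[/imsetP[i _ ->] iF]|[i /[!inE] iF ->]].
  by exists i; rewrite ?inE.
by split=> //; apply: imset_f; rewrite inE.
Qed.

Section Monomials.
Local Open Scope ring_scope.
Variable K : fieldType.

Lemma sqfree_mon_cells Q :
  sqfree_mon K (cells Q) = \prod_i \prod_(j | Q i j) xvar K i j.
Proof.
rewrite /sqfree_mon big_imset /=; last by move=> ? ? _ _; apply: mxvec_index_inj.
by rewrite pair_big_dep; apply: eq_bigl => ij; rewrite inE.
Qed.

Lemma u_chainE c A : u_chain K c A = sqfree_mon K (chain_cells c A).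
Proof.
rewrite /sqfree_mon big_imset //= => i j _ _; exact: chain_cell_inj.
Qed.

End Monomials.

End Cells.

Section Multichains.
Variables (d : Order.disp_t) (P : finPOrderType d) (n : nat) (p : 'I_n -> P).
Variable r : nat.
Implicit Types (c : r.-tuple 'I_n) (F : {set 'I_(r * n)}) (k s : nat).

(** The order of [P] read on labels; a preorder, as [p] need not be injective. *)
Definition label_le : rel 'I_n := relpre p <=%O.

Lemma label_le_refl : reflexive label_le.
Proof. by move=> i; apply: lexx. Qed.

Lemma multichainE c : multichain p c = sorted label_le c.
Proof. exact: sorted_map. Qed.

(** [F] meets the graph of every multichain in at least [k] cells. *)
Definition kcover k F : Prop :=
  forall c, multichain p c -> k <= #|chain_cells c [set: 'I_r] :&: F|.

(** The supports of the generators of [I_{r,s}(P)]. *)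
Definition chain_edge s (E : {set 'I_(r * n)}) : Prop :=
  exists c, exists A : {set 'I_r},
    [/\ multichain p c, #|A| = s & E = chain_cells c A].

(** A set misses some [s] cells of a multichain exactly when it meets at most
    [r - s] of its [r] cells. *)
Lemma covers_chain_edge s F :
  s <= r -> covers (chain_edge s) F <-> kcover (r - s + 1) F.
Proof.
move=> sr; split=> [Fcov c cP|Fcov _ [c [A [cP As ->]]]].
  rewrite card_chain_cells addn1 ltnNge; set Z := [set i | _].
  apply/negP => Zle; have /card_geqP[a [a_uniq a_size aZ]] : s <= #|~: Z|.
    by rewrite cardsCs setCK card_ord; lia.
  have aE : #|[set i in a]| = s by rewrite cardsE (card_uniqP a_uniq).
  have [|_ /imsetP[i /[!inE] ia ->] iF] := Fcov (chain_cells c [set i in a]).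
    by exists c, [set i in a].
  by have /[!inE] := aZ i ia; rewrite iF.
have := Fcov c cP; rewrite card_chain_cells; set Z := [set i | _] => Zge.
have /set0Pn[i] : A :&: Z != set0.
  have AZ : #|A :|: Z| <= r by rewrite -[X in _ <= X]card_ord max_card.
  rewrite -card_gt0 -(ltn_add2l #|A :|: Z|) cardsUI As addn0.
  apply: leq_ltn_trans AZ (leq_trans _ (leq_add (leqnn s) Zge)); lia.
rewrite !inE => /andP[iA iF]; exists (mxvec_index i (tnth c i)) => //.
exact: imset_f.
Qed.

Section HIdeals.
Variable K : fieldType.

Lemma chain_idealE s : chain_ideal K p r s = edge_ideal K (chain_edge s).
Proof.
apply: eq_ideal_gen => f.
  move=> [c [A [cP As ->]]]; apply: mem_ideal_gen.
  by exists (chain_cells c A); rewrite ?u_chainE //; exists c, A.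
move=> [E [c [A [cP As ->]]] ->]; apply: mem_ideal_gen.
by exists c, A; rewrite u_chainE.
Qed.

Lemma H_idealE s : s <= r ->
  H_ideal K p r s =
  ideal_gen (fun f => exists2 F, kcover (r - s + 1) F & f = sqfree_mon K F).
Proof.
move=> sr; rewrite /H_ideal chain_idealE alexander_dual_edge_ideal.
by apply: eq_ideal_gen => _ [F FP ->]; apply: mem_ideal_gen; exists F;
  rewrite // ?covers_chain_edge // -covers_chain_edge.
Qed.

End HIdeals.

(** ** The level sets of a set of cells *)

Section Levels.
Variable F : {set 'I_(r * n)}.

(** Membership in [F] for a row index given as a natural number; false for
    indices outside the range. *)
Definition in_row (i : nat) (j : 'I_n) : bool :=
  oapp (fun i' : 'I_r => mxvec_index i' j \in F) false (insub i).

Lemma in_rowE (i : 'I_r) j : in_row i j = (mxvec_index i j \in F).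
Proof. by rewrite /in_row valK. Qed.

(** [height i j] is the least number of cells of [F] met by a chain of length [i]
    ending at the label [j]; the cell [(i, j)], with rows counted from 0, is the
    end of such chains of length [i + 1]. *)
Definition height := low label_le in_row.

Lemma kcover_height k j : 0 < r -> kcover k F -> k <= height r j.
Proof.
move=> r_gt0 Fk.
have [c [c_size c_sorted]] := low_attained in_row label_le_refl j r.-1 j.
rewrite prednK // -/height => ->.
have cr : size (rcons c j) == r by rewrite size_rcons c_size prednK.
have := Fk (Tuple cr); rewrite multichainE => /(_ c_sorted).
rewrite card_chain_cells -sum1_card big_mkcond /=; congr (_ <= _).
apply: eq_bigr => i _; rewrite inE -in_rowE (tnth_nth j) /=.
by case: in_row.
Qed.

End Levels.

(** A [k]-fold cover contains [k] pairwise disjoint covers, namely the level sets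
    of [height]. *)
Lemma kcover_split k F : 0 < r -> kcover k F ->
  exists A : 'I_k -> {set 'I_(r * n)},
    [/\ forall t, kcover 1 (A t), forall t, A t \subset F
      & forall t u, t != u -> [disjoint A t & A u]].
Proof.
move=> r_gt0 Fk.
exists (fun t : 'I_k => cells (fun i j =>
  (mxvec_index i j \in F) && (height F i.+1 j == t.+1))).
split=> [t c c_chain|t|t u tu].
- have c_sorted : sorted label_le c by rewrite -multichainE.
  pose x0 := tnth c (Ordinal r_gt0).
  have t_le : t.+1 <= low label_le (in_row F) (size c) (last x0 c).
    by rewrite size_tuple; apply: leq_trans (ltn_ord t) (kcover_height _ _ _).
  have [j [jc]] := low_hits_level label_le_refl c_sorted (ltn0Sn t) t_le.
  rewrite size_tuple in jc; rewrite -[j]/(val (Ordinal jc)) -tnth_nth in_rowE.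
  move=> jF jt; rewrite card_gt0; apply/set0Pn.
  exists (mxvec_index (Ordinal jc) (tnth c (Ordinal jc))).
  apply/setIP; split; first by apply: imset_f; rewrite inE.
  by rewrite mem_cells jF; apply/eqP.
- by apply: cells_subset => i j /andP[].
- rewrite -setI_eq0; apply/eqP/setP=> v; rewrite in_set0.
  apply/negP => /setIP[/imsetP[[i j] /[!inE] /= /andP[_ /eqP ht] ->]].
  rewrite mem_cells ht eqSS => /andP[_ /eqP/val_inj tuE].
  by rewrite tuE eqxx in tu.
Qed.

(** ** Multichains of poset ideals *)

(** The support of [u_I]. *)
Definition ideal_cells (I : r.-tuple {set P}) : {set 'I_(r * n)} :=
  cells (fun i j => p j \in layer I i).

Lemma u_idealsE (K : fieldType) I :
  u_ideals K p I = sqfree_mon K (ideal_cells I).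
Proof. by rewrite sqfree_mon_cells. Qed.

Lemma ideal_cells_kcover I :
  0 < r -> ideal_multichain I -> kcover 1 (ideal_cells I).
Proof.
move=> r_gt0 [I_ideal _ I_last] c; rewrite multichainE => c_sorted.
pose x0 := tnth c (Ordinal r_gt0).
(* the first position at which the chain lies in the ideal *)
pose Q i := (i < r) && (p (nth x0 c i) \in nth set0 I i).
have exQ : exists i, Q i.
  exists r.-1; rewrite /Q prednK // leqnn.
  by rewrite -[X in nth set0 I X.-1](size_tuple I) nth_last I_last inE.
case: (ex_minnP exQ) => i /andP[ir iI] imin.
rewrite card_gt0; apply/set0Pn.
exists (mxvec_index (Ordinal ir) (tnth c (Ordinal ir))).
apply/setIP; split; first by apply: imset_f; rewrite inE.
rewrite mem_cells inE (tnth_nth x0) (tnth_nth set0) /= iI.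
rewrite andbT; case: i ir imin {iI} => [|i] ir imin /=; first by rewrite inE.
(* otherwise the cell before it would already be in the previous ideal *)
apply: contraTN (ltnSn i) => iI; rewrite -leqNgt; apply: imin.
rewrite /Q ltnW //=; have ir' : i < r by apply: ltnW.
have := I_ideal (Ordinal ir'); rewrite (tnth_nth set0) /=; apply; last exact: iI.
by apply: (sortedP x0 c_sorted); rewrite size_tuple.
Qed.

Lemma kcover_ideal_cells F : 0 < r -> kcover 1 F ->
  exists2 I, ideal_multichain I & ideal_cells I \subset F.
Proof.
move=> r_gt0 Fcov.
(* D i is I_i; the entry of the tuple at position i is I_(i+1) *)
pose D i : {set P} :=
  [set x | [forall j, (p j <= x)%O ==> (0 < height F i j)]].
have DP i x : reflect (forall j, (p j <= x)%O -> 0 < height F i j) (x \in D i).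
  by rewrite inE; apply: 'forall_implyP.
pose I := [tuple of mkseq (fun i => D i.+1) r].
have nthI i : i < r -> nth set0 I i = D i.+1 by move=> ?; rewrite nth_mkseq.
exists I.
  split=> [i x y xy|| ].
  - rewrite (tnth_nth set0) nthI // => /DP yD; apply/DP => j jx.
    exact/yD/(le_trans jx).
  - apply/(sortedP set0) => i; rewrite size_tuple => ir.
    rewrite !nthI ?(ltnW ir) //; apply/subsetP=> x /DP xD; apply/DP => j jx.
    have [y yj] := low_prev (in_row F) label_le_refl i.+1 j.
    rewrite /height => ->; rewrite ltn_addr //; apply: xD.
    exact: le_trans yj jx.
  - rewrite -nth_last size_tuple nthI ?prednK //; apply/setP => x.
    by rewrite [RHS]inE; apply/DP => j _; apply: kcover_height.
apply: cells_subset => i j; rewrite inE (tnth_nth set0) nthI // => /andP[jNI jI].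
have /DP/(_ j (lexx _)) h_gt0 := jI.
(* j lies outside the preceding ideal, so it is above a label of height 0;
   at i = 0 all labels have height 0 *)
have [y yj hy] : exists2 y, label_le y j & height F i y = 0.
  case: i jNI {jI h_gt0} => [[|i]] ir /=.
    by exists j; rewrite ?label_le_refl.
  rewrite nthI ?(ltnW ir) //= => /DP jN; apply: contrapT => no_y.
  by apply: jN => y yj; rewrite lt0n; apply/eqP=> hy; apply: no_y; exists y.
have := low_le (in_row F) label_le_refl i yj.
rewrite -/(height F i y) hy in_rowE => hle.
by move: (leq_trans h_gt0 hle); case: (_ \in F).
Qed.

End Multichains.

Theorem theorem1p1 (K : fieldType) (d : Order.disp_t) (P : finPOrderType d)
    (n : nat) (p : 'I_n -> P) (r s : nat) :
  bijective p -> (1 <= s)%N -> (s <= r)%N ->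
  H_ideal K p r r = ideals_ideal K p r /\
  H_ideal K p r s = sqfree_pow (H_ideal K p r r) (r - s + 1)%N.
Proof.
move=> _ s_gt0 sr; have r_gt0 := leq_trans s_gt0 sr.
rewrite !H_idealE // subnn; split; apply: eq_ideal_gen.
- move=> _ [F FP ->]; have [I IP IF] := kcover_ideal_cells r_gt0 FP.
  by apply: (ideal_gen_sqfree_monS IF); exists I; rewrite ?u_idealsE.
- move=> _ [I IP ->]; apply: mem_ideal_gen; exists (ideal_cells p I).
    exact: ideal_cells_kcover.
  exact: u_idealsE.
- move=> _ [F Fk ->]; apply: mem_ideal_gen.
  split; first exact: sqfree_monomial_sqfree_mon.
  have [A [A1 AF disj]] := kcover_split r_gt0 Fk.
  apply: (ideal_pow_disjoint _ AF disj) => t.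
  by apply: mem_ideal_gen; exists (A t).
- move=> _ [/sqfree_monomialP[F ->] FHk]; apply: mem_ideal_gen; exists F => //.
  move=> c cP; apply/(@degree_ge_sqfree_mon K).
  apply: degree_ge_ideal_pow FHk; apply: ideal_gen_sub.
    exact: degree_ge_is_ideal.
  by move=> _ [E E1 ->]; apply/degree_ge_sqfree_mon/E1.
Qed.
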